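(* Let $q$ be a prime power. Let $\ell=(z,x,y)^\perp$ and $m=(\bar z,\bar x,\bar y)^\perp$ be two non-tangent lines of $\mathcal O$ in $\mathrm{PG}(2,q)$, and write $\Delta=\Delta(\ell)$ and $\bar\Delta=\Delta(m)$. Then: - if $q$ is even, $$\hat\rho(\ell,m)=\frac{(x\bar y+\bar xy)^2+(x\bar z+\bar xz)(y\bar z+\bar yz)}{z^2\bar z^2}=\sigma\!\left(\frac{x\bar y+\bar xy}{z\bar z}\right)+\Delta+\bar\Delta;$$ - if $q$ is odd, $$\hat\rho(\ell,m)=\frac{(2x\bar y+2\bar xy-z\bar z)^2\Delta\bar\Delta}{4}=\sigma\!\left(x\bar y+\bar xy-\frac{z\bar z}{2}\right)\Delta\bar\Delta.$$
   Context: Let $q$ be a prime power. Projective plane and conic. - Points are nonzero column vectors $(X,Y,Z)^\top$ up to scalars, and $(a,b,c)^\perp$ is the line $aX+bY+cZ=0$. - $\mathrm{PG}(2,q)\subset\mathrm{PG}(2,q^2)$. - $P_\xi=(\xi,\xi^2,1)^\top$ and $P_\infty=(0,1,0)^\top$. - $\mathcal O_{q^2}=\{P_\xi:\xi\in\mathbb F_{q^2}\cup\{\infty\}\}$, and $\mathcal O=\{P_\xi:\xi\in\mathbb F_q\cup\{\infty\}\}$. - A non-tangent line of $\mathrm{PG}(2,q)$ meets $\mathcal O$ in $0$ or $2$ points; viewed in $\mathrm{PG}(2,q^2)$ it meets $\mathcal O_{q^2}$ in two points. Cross-ratio. - With $v_x=(x,1)^\top$ and $v_\infty=(1,0)^\top$,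 $\rho(\alpha,\beta,\gamma,\delta)$ (no three equal) is the point $(\det(v_\alpha,v_\gamma)\det(v_\beta,v_\delta),\ \det(v_\alpha,v_\delta)\det(v_\beta,v_\gamma))^\top$ of $\mathrm{PG}(1,q^2)=\mathbb F_{q^2}\cup\{\infty\}$. For finite entries this equals $\frac{(\alpha-\gamma)(\beta-\delta)}{(\alpha-\delta)(\beta-\gamma)}$. The function $f$ on $\mathbb F_{q^2}\cup\{\infty\}$. - $f(w)=1/(w+w^{-1})$ if $q$ is even, and $f(w)=\frac14+\frac1{-2+w+w^{-1}}$ if $q$ is odd, for $w\neq0,1,\infty$. - $f(1)=\infty$, and $f(0)=f(\infty)$ equals $0$ ($q$ even) or $1/4$ ($q$ odd). Modified cross-ratio. - If $\ell\cap\mathcal O_{q^2}=\{P_\alpha,P_\beta\}$ and $m\cap\mathcal O_{q^2}=\{P_\gamma,P_\delta\}$, then $\hat\rho(\ell,m)=f(\rho(\alpha,\beta,\gamma,\delta))$. Auxiliary maps. - $\Delta(\ell)=xy/z^2$ if $q$ is even and $\Delta(\ell)=1/(z^2-4xy)$ if $q$ is odd, for $\ell=(z,x,y)^\perp$. - $\sigma(t)=t^2+t$ if $q$ is even and $\sigma(t)=t^2$ if $q$ is odd. *)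

(* Defs.v *)
From HB Require Import structures.
From mathcomp Require Import all_boot all_order all_algebra.

Set Implicit Arguments.
Unset Strict Implicit.
Unset Printing Implicit Defensive.

Import GRing.Theory.
Local Open Scope ring_scope.

(* [option K] stands for K together with infinity, [None] being infinity. *)

Definition col2 (K : finFieldType) (a b : K) : 'cV[K]_2 :=
  \col_i [:: a; b]`_i.

Definition col3 (K : finFieldType) (a b c : K) : 'cV[K]_3 :=
  \col_i [:: a; b; c]`_i.

(* The point of PG(n - 1, K) with homogeneous coordinates v is encoded as the
   set of all nonzero multiples of v, so that two nonzero vectors give the same
   point iff they are proportional. *)
Definition point (K : finFieldType) (n : nat) (v : 'cV[K]_n) : {set 'cV[K]_n} :=
  [set a *: v | a : K & a != 0].

(* The line u^perp, as a set of points; meaningful for u != 0 only. *)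
Definition line (K : finFieldType) (u : 'cV[K]_3) : {set {set 'cV[K]_3}} :=
  [set point v | v : 'cV[K]_3 & (v != 0) && (u^T *m v == 0)].

Definition conic_point (K : finFieldType) (xi : option K) : {set 'cV[K]_3} :=
  point (if xi is Some x then col3 x (x ^+ 2) 1 else col3 0 1 0).

Definition conic (K : finFieldType) : {set {set 'cV[K]_3}} :=
  [set conic_point xi | xi : option K].

Definition tangent (K : finFieldType) (l : {set {set 'cV[K]_3}}) : bool :=
  #|l :&: conic K| == 1%N.

Definition pvec (K : finFieldType) (x : option K) : 'cV[K]_2 :=
  if x is Some a then col2 a 1 else col2 1 0.

Definition det2 (K : finFieldType) (u v : 'cV[K]_2) : K :=
  \det (row_mx u v : 'M[K]_2).

(* The point (a, b)^T of PG(1, K) as an element of K plus infinity, under the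
   identification of x with pvec x; the value at (0, 0) is junk. *)
Definition ratio (K : finFieldType) (a b : K) : option K :=
  if b == 0 then None else Some (a / b).

Definition rho (K : finFieldType) (a b c d : option K) : option K :=
  ratio (det2 (pvec a) (pvec c) * det2 (pvec b) (pvec d))
        (det2 (pvec a) (pvec d) * det2 (pvec b) (pvec c)).

Definition f_end (K : finFieldType) (q : nat) : K :=
  if odd q then 4^-1 else 0.

Definition f (K : finFieldType) (q : nat) (w : option K) : option K :=
  match w with
  | None => Some (f_end K q)
  | Some w =>
      if w == 0 then Some (f_end K q)
      else if w == 1 then None
      else if odd q then Some (4^-1 + 1 / (- 2 + w + w^-1))
      else Some (1 / (w + w^-1))
  end.

(* The modified cross-ratio of two lines, each meeting the conic of PG(2, K) in
   two points.  By rho_hatE below it does not depend on the order in which the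
   points on each line are listed.  If one of the lines does not meet the conic
   in two points, the value is the junk value infinity. *)
Definition rho_hat (K : finFieldType) (q : nat) (l m : {set {set 'cV[K]_3}}) :
    option K :=
  if [pick t : (option K * option K) * (option K * option K) |
       [&& t.1.1 != t.1.2, t.2.1 != t.2.2,
           l :&: conic K == [set conic_point t.1.1; conic_point t.1.2]
         & m :&: conic K == [set conic_point t.2.1; conic_point t.2.2]]]
  is Some t then f q (rho t.1.1 t.1.2 t.2.1 t.2.2) else None.

(* Delta is a function of the chosen coordinate vector (z, x, y)^T: for odd q it
   is not invariant under rescaling. *)
Definition Delta (K : finFieldType) (q : nat) (z x y : K) : K :=
  if odd q then 1 / (z ^+ 2 - 4 * x * y) else x * y / z ^+ 2.

Definition sigma (K : finFieldType) (q : nat) (t : K) : K :=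
  if odd q then t ^+ 2 else t ^+ 2 + t.

Lemma point_eqP (K : finFieldType) n (u v : 'cV[K]_n) :
  point u = point v -> exists2 a, a != 0 & u = a *: v.
Proof.
move=> e; have: u \in point v.
  by rewrite -e; apply/imsetP; exists 1; rewrite ?inE ?oner_neq0 ?scale1r.
by case/imsetP=> a; rewrite inE => a0 ->; exists a.
Qed.

Lemma conic_point_inj (K : finFieldType) : injective (@conic_point K).
Proof.
move=> [x|] [y|] // /point_eqP [a a0] /matrixP e.
- have := e (@Ordinal 3 2 isT) 0; have := e 0 0.
  by rewrite !mxE /= mulr1 => -> <-; rewrite mul1r.
- have := e (@Ordinal 3 2 isT) 0.
  by rewrite !mxE /= mulr0 => /eqP; rewrite oner_eq0.
- have := e (@Ordinal 3 2 isT) 0.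
  by rewrite !mxE /= mulr1 => /eqP; rewrite eq_sym (negbTE a0).
Qed.

Lemma f_ratioC (K : finFieldType) q (a b : K) :
  f q (ratio a b) = f q (ratio b a).
Proof.
rewrite /ratio; case: (altP (a =P 0)) => [->|a0];
  case: (altP (b =P 0)) => [eb|b0] //=.
- by rewrite mul0r eqxx.
- by rewrite eb mul0r eqxx.
have ab0 : a / b != 0 by rewrite mulf_neq0 ?invr_eq0.
have -> : b / a = (a / b)^-1 by rewrite invf_div.
rewrite invr_eq0 (negbTE ab0) invr_eq1 invrK.
by rewrite addrAC [(a / b)^-1 + _]addrC.
Qed.

Lemma rho_hatE (K : finFieldType) (q : nat) (l m : {set {set 'cV[K]_3}})
    (a b c d : option K) : a != b -> c != d ->
  l :&: conic K = [set conic_point a; conic_point b] ->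
  m :&: conic K = [set conic_point c; conic_point d] ->
  rho_hat q l m = f q (rho a b c d).
Proof.
have two (x y z t : option K) : x != y ->
    [set conic_point x; conic_point y] = [set conic_point z; conic_point t] ->
    (x = z /\ y = t) \/ (x = t /\ y = z).
  move=> xy /setP e; have := e (conic_point x); have := e (conic_point y).
  rewrite !inE !eqxx orbT /= !(inj_eq (@conic_point_inj K)).
  move=> /esym/orP[]/eqP yE /esym/orP[]/eqP xE; subst; auto;
    by rewrite eqxx in xy.
move=> ab cd el em; rewrite /rho_hat; case: pickP => [|/(_ (a, b, (c, d)))].
  move=> [[a' b'] [c' d']] /= /and4P[ab' cd' /eqP el' /eqP em'].
  have swapl x y z t : f q (rho x y z t) = f q (rho y x z t).
    by rewrite /rho f_ratioC; congr (f q (ratio _ _)); apply: mulrC.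
  have swapr x y z t : f q (rho x y z t) = f q (rho x y t z).
    by rewrite /rho f_ratioC.
  rewrite el in el'; rewrite em in em'.
  by case: (two _ _ _ _ ab el') => -[-> ->];
     case: (two _ _ _ _ cd em') => -[-> ->] //;
     rewrite 1?swapr // swapl // swapr.
by rewrite /= ab cd el em !eqxx.
Qed.

(* Main.v *)
Require Import Defs.
From HB Require Import structures.
From mathcomp Require Import all_boot all_order all_algebra.
From mathcomp Require Import fingroup pgroup abelian.
From mathcomp Require Import closed_field finfield ring.

Set Implicit Arguments.
Unset Strict Implicit.

Import GRing.Theory.
Local Open Scope ring_scope.

(** The line [(z, x, y)^perp] meets the conic at the zeros in PG(1, K) of the
    binary quadratic form [x S^2 + z S T + y T^2].  A form over F factors over
    the quadratic extension L, say as [k (S - a T) (S - b T)], and its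
    discriminant is [k^2 (a - b)^2]; it vanishes exactly for the tangents.
    Writing [rho = N / M], one has [N - M = (a - b) (c - d)] up to sign, so that
    [f (N / M) = N M / (N - M)^2], plus [1/4] if q is odd; the claim is then an
    identity between the coefficients and the roots of the two forms. *)

(** * Characteristic and quadratic extensions of finite fields *)

Lemma pnat_card_pchar (F : finFieldType) : [pchar F].-nat #|F|.
Proof.
have [p p_pr pF] := finPcharP F.
rewrite -cardsT (eq_pnat _ (pcharf_eq pF)).
exact: abelem_pgroup (fin_ring_pchar_abelem pF).
Qed.

(** The order is a positive power of the characteristic p, hence even exactly when p = 2. This turns
    the parity of q into invertibility of 2. *)
Lemma two_eq0 (F : finFieldType) : (2 == 0 :> F) = ~~ odd #|F|.
Proof.
have [p p_pr pF] := finPcharP F.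
have : p.-nat #|F| by rewrite -(eq_pnat _ (pcharf_eq pF)) pnat_card_pchar.
case/p_natP=> -[|n] en; first by have := finNzRing_gt1 F; rewrite en.
rewrite en oddX /= -(dvdn_pcharf pF) dvdn_prime2 //.
by apply/idP/idP=> [/eqP->|/(prime_oddPn p_pr)->].
Qed.

(* In an algebraic closure, the Frobenius map t |-> t^q permutes the two roots
   of the polynomial, so its square fixes them. *)
Lemma quadratic_root_ext (F L : finFieldType) (iota : {rmorphism F -> L})
    (b c : F) : #|L| = (#|F| ^ 2)%N ->
  exists r, r ^+ 2 + iota b * r + iota c = 0.
Proof.
move=> hL; have [K [j _]] := countable_algebraic_closure L.
set q := #|F| in hL.
have qK : [pchar K].-nat q.
  rewrite (eq_pnat _ (fmorph_pchar j)) (eq_pnat _ (fmorph_pchar iota)).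
  exact: pnat_card_pchar.
have frob d : j (iota d) ^+ q = j (iota d) by rewrite -!rmorphXn expf_card.
have [r er] := @solve_monicpoly K 2 (fun i => - j (iota [:: c; b]`_i)) isT.
move: er; rewrite !big_ord_recl big_ord0 /= /bump /= => er.
have {}er : r ^+ 2 + j (iota b) * r + j (iota c) = 0 by rewrite er; ring.
have fr : (r ^+ q) ^+ 2 + j (iota b) * r ^+ q + j (iota c) = 0.
  rewrite -[X in X * _]frob -[X in _ + X]frob exprAC -exprMn -!exprDn_pchar //.
  by rewrite er expr0n gtn_eqF // /q; apply/card_gt0P; exists 0.
(* Subtracting the two equations: r^q is either r or the other root - r - b. *)
have fac : (r ^+ q - r) * (r ^+ q + r + j (iota b)) = 0.
  by rewrite -[RHS]subr0 -{2}er -fr; ring.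
have rq : (r ^+ q) ^+ q = r.
  move/eqP: fac; rewrite mulf_eq0 subr_eq0 => /orP[/eqP e|].
    by rewrite !e.
  rewrite -addrA addr_eq0 => /eqP e.
  by rewrite e exprNn_pchar // exprDn_pchar // frob e; ring.
(* Over L, X^|L| - X is the product of all X - a, so its root r is the image of an element of L. *)
have : root (map_poly j ('X^#|L| - 'X)) r.
  rewrite rmorphB /= map_polyXn map_polyX rootE !hornerE hL expnS expn1 exprM.
  by rewrite rq subrr.
rewrite finField_genPoly rmorph_prod /=.
under eq_bigr do rewrite rmorphB /= map_polyX map_polyC /=.
rewrite -big_enum -(big_map j predT (fun a => 'X - a%:P)) root_prod_XsubC.
case/mapP=> s _ ers; exists s; apply: (fmorph_inj j).
by rewrite rmorph0 -er ers !rmorphD rmorphXn rmorphM.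
Qed.

(** * Points of the conic and roots of binary quadratic forms *)

Section Conic.

Variable K : finFieldType.
Implicit Types (a b c d t : option K).

(** Homogeneous coordinates (num : den), with infinity as (1 : 0), so that one formula covers finite
    and infinite points. *)
Definition num t : K := if t is Some s then s else 1.
Definition den t : K := if t is Some _ then 1 else 0.

Lemma det2_pvec a b :
  det2 (pvec a) (pvec b) = num a * den b - den a * num b.
Proof.
have E (u v : 'cV[K]_2) : (row_mx u v : 'M_2) =
    \matrix_(i, j) if j == 0 then u i 0 else v i 0.
  apply/matrixP=> i j; rewrite !mxE -val_eqE.
  by case: splitP => s /= ->; rewrite (ord1 s).
rewrite /det2 E (expand_det_row _ 0) !big_ord_recl big_ord0 /cofactor !det_mx11.
by case: a b => [a|] [b|]; rewrite /= !mxE /=; ring.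
Qed.

Lemma pvec_coords_inj a b : num a * den b - den a * num b = 0 -> a = b.
Proof.
case: a b => [a|] [b|] //=; rewrite ?(mulr1, mul1r, mul0r, mulr0).
- by move/eqP; rewrite subr_eq0 => /eqP->.
- by rewrite sub0r => /eqP; rewrite oppr_eq0 oner_eq0.
- by rewrite subr0 => /eqP; rewrite oner_eq0.
Qed.

Lemma point_in_line (u v : 'cV[K]_3) : v != 0 ->
  (point v \in line u) = (u^T *m v == 0).
Proof.
move=> v0; apply/imsetP/idP => [[w]|uv]; last by exists v; rewrite ?inE ?v0.
rewrite inE => /andP[_ /eqP uw] /point_eqP [a _ ->].
by rewrite -scalemxAr uw scaler0.
Qed.

Lemma conic_point_in_line (z x y : K) t :
  (conic_point t \in line (col3 z x y)) =
  (x * num t ^+ 2 + z * num t * den t + y * den t ^+ 2 == 0).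
Proof.
rewrite point_in_line; last first.
  apply/eqP=> /matrixP e; case: t e => [t|] e.
    have := e (@Ordinal 3 2 isT) 0.
    by rewrite !mxE /= => /eqP; rewrite oner_eq0.
  have := e (@Ordinal 3 1 isT) 0.
  by rewrite !mxE /= => /eqP; rewrite oner_eq0.
have -> (A : 'M[K]_1) : (A == 0) = (A 0 0 == 0).
  by apply/eqP/eqP => [->|e]; [rewrite mxE | rewrite [A]mx11_scalar e raddf0].
rewrite !mxE !big_ord_recl big_ord0 !mxE /=.
by case: t => [t|]; rewrite !mxE /=; congr (_ == 0); ring.
Qed.

(* Coefficientwise,
   [x S^2 + z S T + y T^2 =
    k (den a S - num a T) (den b S - num b T)]. *)
Variant form_factors (z x y k : K) a b : Prop :=
  FormFactors of k != 0 & x = k * (den a * den b)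
    & z = - k * (num a * den b + den a * num b) & y = k * (num a * num b).

(** At the conic point t the form takes the value k det(t, a) det(t, b). The case a = b is included
    and yields tangents. *)
Lemma line_conic z x y k a b : form_factors z x y k a b ->
  line (col3 z x y) :&: conic K = [set conic_point a; conic_point b].
Proof.
case=> k0 ex ez ey.
have inl t : (conic_point t \in line (col3 z x y)) = (t == a) || (t == b).
  rewrite conic_point_in_line.
  have -> : x * num t ^+ 2 + z * num t * den t + y * den t ^+ 2 =
      k * ((num t * den a - den t * num a) * (num t * den b - den t * num b)).
    by rewrite ex ez ey; ring.
  rewrite !mulf_eq0 (negbTE k0) /=; apply/orP/orP => -[] /eqP e.
  - by left; apply/eqP/pvec_coords_inj.
  - by right; apply/eqP/pvec_coords_inj.
  - by left; rewrite e mulrC subrr.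
  - by right; rewrite e mulrC subrr.
apply/setP=> p; rewrite !inE; apply/andP/orP => [[+ /imsetP[t _ ep]]|].
  by rewrite ep inl => /orP[] /eqP->; [left|right].
by case=> /eqP->; rewrite inl eqxx ?orbT; split=> //; apply/imsetP; eexists.
Qed.

Lemma discriminant z x y k a b : form_factors z x y k a b ->
  z ^+ 2 - 4 * x * y = k ^+ 2 * (num a * den b - den a * num b) ^+ 2.
Proof. by case=> _ -> -> ->; ring. Qed.

(** The other root comes from Vieta: the roots sum to - z / x. *)
Lemma factors_of_root z x y r : x != 0 -> x * r ^+ 2 + z * r + y = 0 ->
  form_factors z x y x (Some r) (Some (- z / x - r)).
Proof.
move=> x0 e; split=> //=; first by rewrite !mulr1.
- by field.
- by rewrite -[LHS]subr0 -e; field.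
Qed.

Lemma factors_x0 z x y : x = 0 -> z != 0 ->
  form_factors z x y (- z) None (Some (- y / z)).
Proof.
by move=> -> z0; split; rewrite /= ?oppr_eq0 //; field.
Qed.

(** By contraposition: a nonzero form of zero discriminant has a double root already in K, so its
    line meets the conic in one point. *)
Lemma nontangent_discriminant (z x y : K) : col3 z x y != 0 ->
  ~~ tangent (line (col3 z x y)) -> z ^+ 2 - 4 * x * y != 0.
Proof.
move=> u0; apply: contra => /eqP d0.
suff [k [a [b fab]]] : exists k a b, form_factors z x y k a b.
  have e : a = b.
    move: (discriminant fab); rewrite d0 => /esym/eqP.
    case: fab => k0 _ _ _; rewrite mulf_eq0 !expf_eq0 /= (negbTE k0) /=.
    by move/eqP/pvec_coords_inj.
  by rewrite /tangent (line_conic fab) e setUid cards1.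
have [x0|x0] := eqVneq x 0.
  have z0 : z = 0.
    by move/eqP: d0; rewrite x0 mulr0 mul0r subr0 expf_eq0 => /eqP.
  (* The form is y T^2, with infinity as double root. *)
  exists y, None, None.
  split; rewrite /= ?x0 ?z0 ?(mulr0, mul0r, addr0, mulr1) //.
  apply: contra u0 => /eqP y0; apply/eqP/matrixP=> i j.
  by rewrite !mxE x0 y0 z0; case: i => [[|[|[|]]]].
suff [r er] : exists r, x * r ^+ 2 + z * r + y = 0.
  by exists x, (Some r), (Some (- z / x - r)); apply: factors_of_root.
(* For 2 invertible the double root is - z / (2 x); in characteristic 2, zero discriminant forces z
   = 0 and the root is a square root of - y / x. *)
have [c2|c2] := eqVneq (2 : K) 0; last first.
  exists (- z / (2 * x)); apply: (mulfI (mulf_neq0 c2 x0)).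
  apply: (mulfI c2); rewrite !mulr0 -[RHS]oppr0 -d0; field.
  by rewrite x0 c2.
have z0 : z = 0.
  suff /eqP : z ^+ 2 = 0 by rewrite expf_eq0 => /eqP.
  have -> : z ^+ 2 = z ^+ 2 - 4 * x * y + 2 * (2 * x * y) by ring.
  by rewrite d0 c2 mul0r addr0.
(* [t^q = t], so for even q the element t has the square root t^(q/2). *)
exists ((- y / x) ^+ #|K|./2).
have /negbTE ev : ~~ odd #|K| by rewrite -two_eq0 c2.
rewrite -exprM muln2 -[X in _ ^+ X]add0n -[0%N]/(nat_of_bool false) -{1}ev.
by rewrite odd_double_half expf_card z0; field.
Qed.

End Conic.

Lemma factors_ext (F L : finFieldType) (iota : {rmorphism F -> L}) (z x y : F) :
    #|L| = (#|F| ^ 2)%N -> z ^+ 2 - 4 * x * y != 0 ->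
  exists k a b, form_factors (iota z) (iota x) (iota y) k a b.
Proof.
move=> hL d0; have [x0|x0] := eqVneq x 0.
  exists (- iota z), None, (Some (- iota y / iota z)).
  apply: factors_x0; first by rewrite x0 rmorph0.
  by move: d0; rewrite x0 mulr0 mul0r subr0 expf_eq0 fmorph_eq0.
have [r er] := quadratic_root_ext iota (z / x) (y / x) hL.
have X0 : iota x != 0 by rewrite fmorph_eq0.
exists (iota x), (Some r), (Some (- iota z / iota x - r)).
apply: factors_of_root => //; rewrite -[RHS](mulr0 (iota x)) -er !fmorph_div.
by field.
Qed.

(** * Evaluation of the modified cross-ratio *)

(** The formula also covers the arguments 0 and infinity, where n m = 0 leaves [f_end]; n != m
    excludes the argument 1 and the junk ratio of (0, 0). *)
Lemma f_ratio (K : finFieldType) q (n m : K) :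
    (2 == 0 :> K) = ~~ odd q -> n != m ->
  f q (Defs.ratio n m) = Some (f_end K q + n * m / (n - m) ^+ 2).
Proof.
move=> h2 nm; rewrite /Defs.ratio; have [->|m0] := eqVneq m 0.
  by rewrite /= mulr0 mul0r addr0.
rewrite /= mulf_eq0 invr_eq0 (negbTE m0) orbF.
have [->|n0] := eqVneq n 0; first by rewrite !mul0r addr0.
have d0 : n - m != 0 by rewrite subr_eq0.
have E : 1 / (- 2 + n / m + (n / m)^-1) = n * m / (n - m) ^+ 2.
  have -> : - 2 + n / m + (n / m)^-1 = (n - m) ^+ 2 / (n * m).
    by field; rewrite n0 m0.
  by field; rewrite n0 m0 d0.
rewrite -subr_eq0; have -> : n / m - 1 = (n - m) / m by field.
rewrite mulf_eq0 invr_eq0 (negbTE m0) (negbTE d0) /= /f_end.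
case: ifPn => [_|]; first by rewrite E.
by rewrite -h2 -E => /eqP->; rewrite oppr0 !add0r.
Qed.

(** Here q enters by its parity only, so the computation can take place over the quadratic
    extension. *)
Lemma rho_hat_factors (K : finFieldType) q (z x y z' x' y' k k' : K) a b c d :
    (2 == 0 :> K) = ~~ odd q ->
    form_factors z x y k a b -> form_factors z' x' y' k' c d ->
    z ^+ 2 - 4 * x * y != 0 -> z' ^+ 2 - 4 * x' * y' != 0 ->
  rho_hat q (line (col3 z x y)) (line (col3 z' x' y')) =
  Some (if odd q
        then (2 * x * y' + 2 * x' * y - z * z') ^+ 2 *
             (1 / (z ^+ 2 - 4 * x * y)) * (1 / (z' ^+ 2 - 4 * x' * y')) / 4
        else ((x * y' + x' * y) ^+ 2 +
              (x * z' + x' * z) * (y * z' + y' * z)) / (z ^+ 2 * z' ^+ 2)).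
Proof.
move=> h2 fab fcd d0 d0'.
have disc := discriminant fab; have disc' := discriminant fcd.
have ab : num a * den b - den a * num b != 0.
  by move: d0; rewrite disc mulf_eq0 !expf_eq0 /= negb_or => /andP[].
have cd : num c * den d - den c * num d != 0.
  by move: d0'; rewrite disc' mulf_eq0 !expf_eq0 /= negb_or => /andP[].
have ne (s t : option K) : num s * den t - den s * num t != 0 -> s != t.
  by apply: contraNneq => ->; rewrite mulrC subrr.
rewrite (rho_hatE q (ne _ _ ab) (ne _ _ cd) (line_conic fab) (line_conic fcd)).
rewrite /rho !det2_pvec.
set n := _ * _; set m := _ * _.
(* The Plücker relation among the four vectors. *)
have nm : n - m = (num a * den b - den a * num b) *
                  (num c * den d - den c * num d) by rewrite /n /m; ring.
rewrite f_ratio //; last by rewrite -subr_eq0 nm mulf_neq0.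
congr Some; rewrite nm /f_end; have [k0 ex ez ey] := fab.
have [k0' ex' ez' ey'] := fcd.
case: ifPn => [qo|]; last rewrite -h2 => /eqP c2.
  (* The polarised discriminant produces n + m, and 1/4 + n m / (n - m)^2 = (n + m)^2 / (4 (n -
     m)^2). *)
  have -> : 2 * x * y' + 2 * x' * y - z * z' = k * k' * (n + m).
    by rewrite /n /m ex ey ez ex' ey' ez'; ring.
  have sq : (n + m) ^+ 2 = (n - m) ^+ 2 + 4 * (n * m) by ring.
  have t0 : (4 : K) != 0 by rewrite (natrM _ 2 2) mulf_neq0 ?h2 ?qo.
  rewrite [(k * k' * _) ^+ 2]exprMn sq nm disc disc'; field.
  by rewrite k0 k0' ab cd t0.
(* In characteristic 2 the discriminant is z^2, so the denominator is a product of discriminants. *)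
have sq (t u v : K) : t ^+ 2 = t ^+ 2 - 4 * u * v.
  have -> : 4 * u * v = 2 * (2 * u * v) by ring.
  by rewrite c2 mul0r subr0.
rewrite (sq z x y) (sq z' x' y') disc disc' add0r.
(* The term k^2 k'^2 n m is the resultant of the two forms; the numerator differs from it by a
   multiple of 2. *)
have -> : (x * y' + x' * y) ^+ 2 + (x * z' + x' * z) * (y * z' + y' * z) =
    k ^+ 2 * k' ^+ 2 * (n * m) +
    2 * ((x * y' + x' * y) * (z * z') + 2 * (x * y * x' * y')).
  by rewrite /n /m ex ey ez ex' ey' ez'; ring.
rewrite c2 mul0r addr0.
by field; rewrite k0 k0' ab cd.
Qed.

Theorem mainTheorem11 (q : nat) (F L : finFieldType) (iota : {rmorphism F -> L})
    (hF : #|F| = q) (hL : #|L| = (q ^ 2)%N)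
    (z x y z' x' y' : F)
    (hl : col3 z x y != 0) (hm : col3 z' x' y' != 0)
    (hlT : ~~ tangent (line (col3 z x y)))
    (hmT : ~~ tangent (line (col3 z' x' y'))) :
  let l := line (map_mx iota (col3 z x y)) in
  let m := line (map_mx iota (col3 z' x' y')) in
  let D := Delta q z x y in
  let D' := Delta q z' x' y' in
  (~~ odd q ->
     let r := ((x * y' + x' * y) ^+ 2 +
                 (x * z' + x' * z) * (y * z' + y' * z))
              / (z ^+ 2 * z' ^+ 2) in
     rho_hat q l m = Some (iota r) /\
     r = sigma q ((x * y' + x' * y) / (z * z')) + D + D') /\
  (odd q ->
     let r := (2 * x * y' + 2 * x' * y - z * z') ^+ 2 * D * D' / 4 in
     rho_hat q l m = Some (iota r) /\
     r = sigma q (x * y' + x' * y - z * z' / 2) * D * D').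
Proof.
move=> l m D D'; have odd2 := two_eq0 F; rewrite hF in odd2.
have hLF : #|L| = (#|F| ^ 2)%N by rewrite hF.
have d0 := nontangent_discriminant hl hlT.
have d0' := nontangent_discriminant hm hmT.
have [k [a [b fab]]] := factors_ext iota hLF d0.
have [k' [c [d fcd]]] := factors_ext iota hLF d0'.
have odd2L : (2 == 0 :> L) = ~~ odd q.
  by rewrite -odd2 -(fmorph_eq0 iota) rmorph_nat.
have iota_disc (u v w : F) :
    iota (u ^+ 2 - 4 * v * w) = iota u ^+ 2 - 4 * iota v * iota w.
  by rewrite rmorphB rmorphXn !rmorphM rmorph_nat.
have iota_col3 (u v w : F) :
    map_mx iota (col3 u v w) = col3 (iota u) (iota v) (iota w).
  by apply/matrixP=> i j; rewrite !mxE; case: i => [[|[|[|]]]].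
have E := rho_hat_factors odd2L fab fcd.
rewrite -!iota_disc !fmorph_eq0 in E; move/(_ d0 d0'): E.
rewrite /l /m !iota_col3 /D /D' /Delta /sigma => ->.
split=> [/[dup] qe /negbTE ->|qo]; split.
- by rewrite !(rmorphXn, rmorphD, rmorphM, fmorphV).
(* For even q the discriminant is z^2, so the denominators z and z' are nonzero. *)
- have z0 (u v w : F) : u ^+ 2 - 4 * v * w != 0 -> u != 0.
    apply: contraNneq => ->.
    have -> : 0 ^+ 2 - 4 * v * w = 2 * (- 2 * v * w) by ring.
    by move: qe; rewrite -odd2 => /eqP->; rewrite mul0r.
  by field; rewrite (z0 _ _ _ d0) (z0 _ _ _ d0').
- by rewrite qo !(rmorphXn, rmorphB, rmorphD, rmorphM, fmorphV, rmorph1).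
- have t0 : (2 : F) != 0 by rewrite odd2 qo.
  have t1 : (4 : F) != 0 by rewrite (natrM _ 2 2) mulf_neq0.
  by rewrite qo; field; rewrite d0 d0' t0 t1.
Qed.
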